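(* Let $p,q$ be two positive prime integers with $p\neq q$ and $q>5$, and let $n$ be a positive integer. Then the generalized Fibonacci-Lucas quaternion $G^{p,q}_n=g^{p,q}_n+g^{p,q}_{n+1}i+g^{p,q}_{n+2}j+g^{p,q}_{n+3}k$ is a zero divisor in the quaternion ring $\mathbb{H}_{\mathbb{Z}_q}(-1,-1)$ if and only if there exists an integer $l\ge 0$ such that $n=\frac{(2l+1)z(q)-1}{2}$, where $z(q)$ is the entry point of $q$ in the Fibonacci sequence.
   Context: $(f_n)_{n\ge 0}$ is the Fibonacci sequence ($f_0=0$, $f_1=1$, $f_n=f_{n-1}+f_{n-2}$ for $n\ge2$) and $(l_n)_{n\ge 0}$ the Lucas sequence ($l_0=2$, $l_1=1$, $l_n=l_{n-1}+l_{n-2}$ for $n\ge2$). For integers $p,q$ the generalized Fibonacci-Lucas numbers are $g^{p,q}_{n+1}=p f_n+q\, l_{n+1}$, $n\ge 0$. For a prime $r$, the entry point $z(r)$ is the smallest positive integer $z$ with $r\mid f_z$; $\mathbb{Z}_r=\mathbb{Z}/r\mathbb{Z}$, and $\mathbb{H}_{\mathbb{Z}_r}(-1,-1)$ is the 4-dimensional associative unital $\mathbb{Z}_r$-algebra with basis $\{1,i,j,k\}$ and relations $i^2=j^2=-1$, $k=ij=-ji$. Integer coefficients are reduced modulo $r$. An element $x$ of a ring is a zero divisor if there is a nonzero $y$ with $xy=0$ or $yx=0$ (so $0$ counts as a zero divisor). *)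

(* Defs.v *)
From HB Require Import structures.
From mathcomp Require Import all_boot all_order all_algebra.
From mathcomp Require Import ring.

Set Implicit Arguments.
Unset Strict Implicit.
Unset Printing Implicit Defensive.

Import GRing.Theory.
Local Open Scope ring_scope.

Fixpoint fib (n : nat) : nat :=
  if n is n'.+1 then (if n' is n''.+1 then fib n' + fib n'' else 1)%N else 0%N.

Fixpoint lucas (n : nat) : nat :=
  if n is n'.+1 then (if n' is n''.+1 then lucas n' + lucas n'' else 1)%N
  else 2%N.

(* g^{p,q}_n = p f_{n-1} + q l_n, meaningful for n >= 1 only: at n = 0 the
   truncated predecessor would read f_{-1} as f_0. *)
Definition gfl (p q : int) (n : nat) : int :=
  p * (fib n.-1)%:Z + q * (lucas n)%:Z.

(* Pairs of consecutive Fibonacci numbers modulo r form an orbit of an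
   injective map on a finite type, so the pair (0, 1) recurs. *)
Definition fib_step (R : zmodType) (x : R * R) : R * R := (x.2, x.1 + x.2).

Lemma fib_step_inj (R : zmodType) : injective (@fib_step R).
Proof. by move=> [a b] [c d] [-> /addIr ->]. Qed.

Lemma iter_fib_step (R : nzRingType) n :
  iter n (@fib_step R) (0, 1) = ((fib n)%:R, (fib n.+1)%:R).
Proof. by elim: n => //= n ->; rewrite /fib_step /= -natrD addnC. Qed.

Lemma entry_point_exists (r : nat) :
  exists n, (0 < n)%N && ((0 < r)%N ==> (r %| fib n)%N).
Proof.
case: r => [|[|r]]; [by exists 1%N | by exists 1%N; rewrite dvd1n |].
pose f := @fib_step 'Z_r.+2; exists (fingraph.order f (0, 1)).
rewrite fingraph.order_gt0 /=.
have := iter_order (@fib_step_inj 'Z_r.+2) (0, 1).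
rewrite -/f iter_fib_step => -[/(congr1 val) /=].
by rewrite val_Zp_nat // => /eqP.
Qed.

(* The guard 0 < r only makes the function total: 0 divides no f_n with
   n > 0. *)
Definition entry_point (r : nat) : nat := ex_minn (entry_point_exists r).

Lemma entry_pointP (r : nat) : (0 < r)%N ->
  [/\ (0 < entry_point r)%N, (r %| fib (entry_point r))%N &
      forall n, (0 < n)%N -> (r %| fib n)%N -> (entry_point r <= n)%N].
Proof.
rewrite /entry_point => r_gt0; case: ex_minnP => m.
rewrite r_gt0 => /andP[m_gt0 rm] min_m; split=> // n n_gt0 rn.
by apply: min_m; rewrite n_gt0.
Qed.

Record quaternion (R : comNzRingType) (a b : R) := Quaternion {
  quat_re : R; quat_i : R; quat_j : R; quat_k : R }.

Definition quat_encode (R : comNzRingType) (a b : R) (x : quaternion a b) :=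
  (quat_re x, quat_i x, quat_j x, quat_k x).
Definition quat_decode (R : comNzRingType) (a b : R) (x : R * R * R * R) :=
  let: (x0, x1, x2, x3) := x in @Quaternion R a b x0 x1 x2 x3.
Lemma quat_encodeK (R : comNzRingType) (a b : R) :
  cancel (@quat_encode R a b) (@quat_decode R a b).
Proof. by case. Qed.
HB.instance Definition _ (R : comNzRingType) (a b : R) :=
  Choice.copy (quaternion a b) (can_type (@quat_encodeK R a b)).

Definition quat_zero (R : comNzRingType) (a b : R) : quaternion a b :=
  Quaternion a b 0 0 0 0.
Definition quat_one (R : comNzRingType) (a b : R) : quaternion a b :=
  Quaternion a b 1 0 0 0.
Definition quat_opp (R : comNzRingType) (a b : R) (x : quaternion a b) :=
  let: Quaternion x0 x1 x2 x3 := x in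
  Quaternion a b (- x0) (- x1) (- x2) (- x3).
Definition quat_add (R : comNzRingType) (a b : R) (x y : quaternion a b) :=
  let: Quaternion x0 x1 x2 x3 := x in
  let: Quaternion y0 y1 y2 y3 := y in
  Quaternion a b (x0 + y0) (x1 + y1) (x2 + y2) (x3 + y3).
Definition quat_scale (R : comNzRingType) (a b : R) (c : R)
    (x : quaternion a b) :=
  let: Quaternion x0 x1 x2 x3 := x in
  Quaternion a b (c * x0) (c * x1) (c * x2) (c * x3).
(* Bilinear extension of i^2 = a, j^2 = b, ij = - ji = k. *)
Definition quat_mul (R : comNzRingType) (a b : R) (x y : quaternion a b) :=
  let: Quaternion x0 x1 x2 x3 := x in
  let: Quaternion y0 y1 y2 y3 := y in
  Quaternion a b
    (x0 * y0 + a * (x1 * y1) + b * (x2 * y2) - a * b * (x3 * y3))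
    (x0 * y1 + x1 * y0 - b * (x2 * y3) + b * (x3 * y2))
    (x0 * y2 + x2 * y0 + a * (x1 * y3) - a * (x3 * y1))
    (x0 * y3 + x3 * y0 + x1 * y2 - x2 * y1).

Ltac quat_ring :=
  repeat (let x := fresh "x" in intro x; try case: x => ? ? ? ?);
  rewrite /quat_zero /quat_one /=; congr Quaternion; ring.

Lemma quat_addA (R : comNzRingType) (a b : R) : associative (@quat_add R a b).
Proof. quat_ring. Qed.
Lemma quat_addC (R : comNzRingType) (a b : R) : commutative (@quat_add R a b).
Proof. quat_ring. Qed.
Lemma quat_add0 (R : comNzRingType) (a b : R) :
  left_id (@quat_zero R a b) (@quat_add R a b).
Proof. quat_ring. Qed.
Lemma quat_addN (R : comNzRingType) (a b : R) :
  left_inverse (@quat_zero R a b) (@quat_opp R a b) (@quat_add R a b).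
Proof. quat_ring. Qed.
HB.instance Definition _ (R : comNzRingType) (a b : R) :=
  GRing.isZmodule.Build (quaternion a b)
    (@quat_addA R a b) (@quat_addC R a b) (@quat_add0 R a b) (@quat_addN R a b).

Lemma quat_mulA (R : comNzRingType) (a b : R) : associative (@quat_mul R a b).
Proof. quat_ring. Qed.
Lemma quat_mul1l (R : comNzRingType) (a b : R) :
  left_id (@quat_one R a b) (@quat_mul R a b).
Proof. quat_ring. Qed.
Lemma quat_mul1r (R : comNzRingType) (a b : R) :
  right_id (@quat_one R a b) (@quat_mul R a b).
Proof. quat_ring. Qed.
Lemma quat_mulDl (R : comNzRingType) (a b : R) :
  left_distributive (@quat_mul R a b) (@quat_add R a b).
Proof. quat_ring. Qed.
Lemma quat_mulDr (R : comNzRingType) (a b : R) :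
  right_distributive (@quat_mul R a b) (@quat_add R a b).
Proof. quat_ring. Qed.
Lemma quat_one_neq0 (R : comNzRingType) (a b : R) :
  @quat_one R a b != 0.
Proof. by apply/eqP=> -[] /eqP; rewrite oner_eq0. Qed.
HB.instance Definition _ (R : comNzRingType) (a b : R) :=
  GRing.Zmodule_isNzRing.Build (quaternion a b)
    (@quat_mulA R a b) (@quat_mul1l R a b) (@quat_mul1r R a b)
    (@quat_mulDl R a b) (@quat_mulDr R a b) (@quat_one_neq0 R a b).

Lemma quat_scaleA (R : comNzRingType) (a b c d : R) (x : quaternion a b) :
  quat_scale c (quat_scale d x) = quat_scale (c * d) x.
Proof. move: x; quat_ring. Qed.
Lemma quat_scale1 (R : comNzRingType) (a b : R) :
  left_id 1 (@quat_scale R a b).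
Proof. quat_ring. Qed.
Lemma quat_scaleDr (R : comNzRingType) (a b : R) :
  right_distributive (@quat_scale R a b) +%R.
Proof. quat_ring. Qed.
Lemma quat_scaleDl (R : comNzRingType) (a b : R) (x : quaternion a b) :
  {morph (@quat_scale R a b)^~ x : c d / c + d}.
Proof. move: x; quat_ring. Qed.
HB.instance Definition _ (R : comNzRingType) (a b : R) :=
  GRing.Zmodule_isLmodule.Build R (quaternion a b)
    (@quat_scaleA R a b) (@quat_scale1 R a b)
    (@quat_scaleDr R a b) (@quat_scaleDl R a b).

Lemma quat_scaleAl (R : comNzRingType) (a b c : R) (x y : quaternion a b) :
  c *: (x * y) = c *: x * y.
Proof. move: x y; quat_ring. Qed.
HB.instance Definition _ (R : comNzRingType) (a b : R) :=
  GRing.Lmodule_isLalgebra.Build R (quaternion a b) (@quat_scaleAl R a b).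
Lemma quat_scaleAr (R : comNzRingType) (a b c : R) (x y : quaternion a b) :
  c *: (x * y) = x * (c *: y).
Proof. move: x y; quat_ring. Qed.
HB.instance Definition _ (R : comNzRingType) (a b : R) :=
  GRing.Lalgebra_isAlgebra.Build R (quaternion a b) (@quat_scaleAr R a b).

Definition qi (R : comNzRingType) (a b : R) : quaternion a b :=
  Quaternion a b 0 1 0 0.
Definition qj (R : comNzRingType) (a b : R) : quaternion a b :=
  Quaternion a b 0 0 1 0.
Definition qk (R : comNzRingType) (a b : R) : quaternion a b :=
  Quaternion a b 0 0 0 1.

Lemma quaternion_relations (R : comNzRingType) (a b : R) :
  [/\ qi a b * qi a b = a%:A, qj a b * qj a b = b%:A,
      qi a b * qj a b = qk a b & qj a b * qi a b = - qk a b].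
Proof. split; rewrite /qi /qj /qk; quat_ring. Qed.

Lemma quaternion_basis (R : comNzRingType) (a b x0 x1 x2 x3 : R) :
  x0 *: 1 + x1 *: qi a b + x2 *: qj a b + x3 *: qk a b
    = Quaternion a b x0 x1 x2 x3.
Proof. by rewrite /qi /qj /qk; congr Quaternion; ring. Qed.

(* G^{p,q}_n in H_R(-1,-1), with integer coefficients mapped into R. *)
Definition gfl_quaternion (R : comNzRingType) (p q : int) (n : nat) :
    quaternion (-1 : R) (-1) :=
  let g m : R := (gfl p q m)%:~R in
  g n *: 1 + g n.+1 *: qi (-1) (-1) + g n.+2 *: qj (-1) (-1)
    + g n.+3 *: qk (-1) (-1).

(* By this convention 0 is a zero divisor. *)
Definition zero_divisor (R : nzRingType) (x : R) : Prop :=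
  exists2 y : R, y != 0 & x * y = 0 \/ y * x = 0.

(* Main.v *)
Require Import Defs.
From mathcomp Require Import all_boot all_order all_algebra.
From mathcomp Require Import ring.

(** Modulo q the Lucas part of g^{p,q}_k vanishes, so the quaternion with
    index n = m + 1 has the four coefficients p f_m, ..., p f_(m+3).  Over a
    field, an element x of a quaternion algebra divides zero exactly when its
    norm vanishes, because x and its conjugate multiply, in either order, to
    that norm ([zero_divisor_quat_norm]).  The norm here is p^2 times a sum of
    four consecutive squares of Fibonacci numbers, and that sum is
    3 f_(2m+3) = 3 f_(2n+1) ([fib_sum_four_squares]).  As the prime q differs
    from p and from 3, the condition becomes q | f_(2n+1), that is,
    z(q) | 2n + 1 ([dvdn_fib]).  The cofactor of z(q) in the odd number 2n + 1
    is itself odd, which produces the 2l + 1 of the theorem. *)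

Import GRing.Theory Num.Theory.
Local Open Scope ring_scope.

Section Fibonacci.
Local Open Scope nat_scope.

Lemma fibSS n : fib n.+2 = fib n.+1 + fib n.
Proof. by []. Qed.

Lemma fib_add m n : fib (m + n).+1 = fib m.+1 * fib n.+1 + fib m * fib n.
Proof.
elim: m n => [|m IHm] n; first by rewrite add0n mul1n mul0n addn0.
by rewrite addSnnS IHm !fibSS; ring.
Qed.

Lemma coprime_fibS n : coprime (fib n) (fib n.+1).
Proof. by elim: n => // n IHn; rewrite fibSS /coprime gcdnDl gcdnC. Qed.

(** By the addition formula f_(m+z) = f_(m+1) f_z + f_m f_(z-1).  Modulo r the
    first term vanishes and f_(z-1), being coprime to f_z, is invertible, so
    divisibility by r only depends on the index modulo z; below z, minimality
    of the entry point leaves the index 0. *)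
Lemma dvdn_fib r n : 0 < r -> (r %| fib n) = (entry_point r %| n).
Proof.
move=> /entry_pointP[]; case: (entry_point r) => // z _ r_fz z_min.
have r_shift m : (r %| fib (m + z.+1)) = (r %| fib m).
  rewrite addnS fib_add (dvdn_addr _ (dvdn_mull _ r_fz)).
  apply: Gauss_dvdl; apply: coprime_dvdl r_fz _.
  by rewrite coprime_sym coprime_fibS.
have r_mod k m : (r %| fib (k * z.+1 + m)) = (r %| fib m).
  elim: k => [|k IHk]; first by rewrite mul0n.
  by rewrite mulSn -addnA addnC r_shift IHk.
rewrite {1}(divn_eq n z.+1) r_mod [RHS]/dvdn.
case: posnP => [-> | n_mod_gt0]; first exact: dvdn0.
apply/negP => /(z_min _ n_mod_gt0).
by rewrite leqNgt ltn_pmod.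
Qed.

(** Grouping the squares in consecutive pairs gives f_(2m+1) + f_(2m+5), and
    f_(k-2) + f_(k+2) = 3 f_k. *)
Lemma fib_sum_four_squares m :
  fib m ^ 2 + fib m.+1 ^ 2 + fib m.+2 ^ 2 + fib m.+3 ^ 2
    = 3 * fib m.+1.*2.+1.
Proof. by rewrite -addnn fib_add !fibSS; ring. Qed.

End Fibonacci.

Definition quat_conj {R : comNzRingType} {a b : R} (x : quaternion a b) :=
  let: Quaternion x0 x1 x2 x3 := x in
  Quaternion a b x0 (- x1) (- x2) (- x3).

Definition quat_norm {R : comNzRingType} {a b : R} (x : quaternion a b) : R :=
  let: Quaternion x0 x1 x2 x3 := x in
  x0 ^+ 2 - a * x1 ^+ 2 - b * x2 ^+ 2 + a * b * x3 ^+ 2.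

Lemma quat_mul_conj {R : comNzRingType} {a b : R} (x : quaternion a b) :
  x * quat_conj x = (quat_norm x)%:A.
Proof. by case: x => x0 x1 x2 x3; congr Quaternion => /=; ring. Qed.

Lemma quat_conj_mul {R : comNzRingType} {a b : R} (x : quaternion a b) :
  quat_conj x * x = (quat_norm x)%:A.
Proof. by case: x => x0 x1 x2 x3; congr Quaternion => /=; ring. Qed.

Lemma quat_conj_eq0 {R : comNzRingType} {a b : R} (x : quaternion a b) :
  quat_conj x = 0 -> x = 0.
Proof.
case: x => x0 x1 x2 x3 [-> /eqP + /eqP + /eqP].
by rewrite !oppr_eq0 => /eqP-> /eqP-> /eqP->.
Qed.

(** If the norm is 0, the conjugate of x is a partner of x, except that x = 0
    needs the partner 1.  If it is not, cancelling x against its conjugate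
    turns x y = 0 or y x = 0 into a nonzero scalar times y being 0. *)
Lemma zero_divisor_quat_norm {F : fieldType} {a b : F} (x : quaternion a b) :
  zero_divisor x <-> quat_norm x = 0.
Proof.
split=> [[y y_neq0 xy0] | Nx0].
  apply/eqP/negPn/negP => Nx_neq0; case/eqP: y_neq0.
  suff Ny0 : quat_norm x *: y = 0.
    by rewrite -[y]scale1r -(mulVf Nx_neq0) -scalerA Ny0 scaler0.
  case: xy0 => xy0.
    by rewrite -mulr_algl -quat_conj_mul -mulrA xy0 mulr0.
  by rewrite -mulr_algr -quat_mul_conj mulrA xy0 mul0r.
have [-> | x_neq0] := eqVneq x 0.
  by exists 1; [exact: oner_neq0 | left; rewrite mul0r].
exists (quat_conj x); last by left; rewrite quat_mul_conj Nx0 scale0r.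
by apply: contra_neq x_neq0; exact: quat_conj_eq0.
Qed.

Lemma Fp_nat_eq0 q m : prime q -> ((m%:R : 'F_q) == 0) = (q %| m)%N.
Proof. by move=> q_prime; rewrite -(dvdn_pcharf (pchar_Fp q_prime)). Qed.

Lemma gfl_Fp p q m : prime q ->
  (gfl p%:Z q%:Z m.+1)%:~R = p%:R * (fib m)%:R :> 'F_q.
Proof.
move=> q_prime; rewrite /gfl rmorphD !rmorphM /= -!pmulrn.
by rewrite (pcharf0 (pchar_Fp q_prime)) mul0r addr0.
Qed.

Lemma quat_norm_gfl p q m : prime q ->
  quat_norm (gfl_quaternion 'F_q p%:Z q%:Z m.+1)
    = (p ^ 2 * (3 * fib m.+1.*2.+1))%:R.
Proof.
move=> q_prime; rewrite /gfl_quaternion quaternion_basis !gfl_Fp //.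
by rewrite -fib_sum_four_squares !(natrM, natrD, natrX) /=; ring.
Qed.

Lemma dvdn_odd_cofactor z n :
  (z %| n.*2.+1)%N <-> exists l, n.*2.+1 = (l.*2.+1 * z)%N.
Proof.
split=> [/dvdnP[k def_n] | [l ->]]; last exact: dvdn_mull.
have k_odd : odd k.
  by have := congr1 odd def_n; rewrite oddM /= odd_double; case: (odd k).
by exists k./2; rewrite def_n -{1}(odd_double_half k) k_odd.
Qed.

Lemma half_odd_multipleE (n l z : nat) :
  n%:Q = ((2 * l%:Q + 1) * z%:Q - 1) / 2 <-> n.*2.+1 = (l.*2.+1 * z)%N.
Proof.
have half_eq (x y : rat) : x = (y - 1) / 2 <-> 2 * x + 1 = y.
  by split=> [-> | <-]; field.
have to_nat (m : nat) : 2 * m%:Q + 1 = (m.*2.+1)%:R.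
  by rewrite -[RHS]natr1 -mul2n natrM.
rewrite half_eq !to_nat -natrM; split=> [/eqP | -> //].
by rewrite eqr_nat => /eqP.
Qed.

Theorem theorem3p2 (p q n : nat) (p_prime : prime p) (q_prime : prime q)
    (p_neq_q : p != q) (q_gt5 : (5 < q)%N) (n_gt0 : (0 < n)%N) :
  zero_divisor (gfl_quaternion 'F_q p%:Z q%:Z n) <->
  exists l : nat,
    n%:Q = ((2 * l%:Q + 1) * (entry_point q)%:Q - 1) / 2.
Proof.
have q_ndiv_p : ~~ (q %| p)%N by rewrite dvdn_prime2 // eq_sym.
have q_ndiv_3 : ~~ (q %| 3)%N by rewrite gtnNdvd // (ltn_trans _ q_gt5).
have norm_eq0 :
    quat_norm (gfl_quaternion 'F_q p%:Z q%:Z n) = 0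
      <-> (entry_point q %| n.*2.+1)%N.
  (* The coefficients are then indexed from m >= 0, without predecessors. *)
  case: n n_gt0 => // m _.
  rewrite quat_norm_gfl // (rwP eqP) Fp_nat_eq0 // !Euclid_dvdM //.
  by rewrite (negbTE q_ndiv_p) (negbTE q_ndiv_3) dvdn_fib ?prime_gt0.
rewrite zero_divisor_quat_norm norm_eq0 dvdn_odd_cofactor.
by split=> -[l] /half_odd_multipleE; exists l.
Qed.
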